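(* Let $\Delta t$ be a fixed flow time, let $I_-$ be the standard complex structure of $\mathbb{C}P^2$, $I_+=(\phi_{\Delta t*})^{-1}I_-\phi_{\Delta t*}$, and let $F$ be the 2-form with $I_+-I_-=-QF$ given by $F=d\int_0^{\Delta t}\phi_t^*(I_-^*dh)\,dt$. Then $$F=-(I_+^*d\theta_1-I_-^*d\theta_1)\wedge d\theta_2+(I_+^*d\theta_2-I_-^*d\theta_2)\wedge d\theta_1 .$$
   Context: Let $z^1,z^2$ be the standard inhomogeneous coordinates of $\mathbb{C}P^2$, $\theta_a=\arg z^a$, $y^a=|z^a|^2/(1+|z^1|^2+|z^2|^2)$ for $a=1,2$, $y^3=1-y^1-y^2$. Let $\sigma=iz^1z^2\,\partial_{z^1}\wedge\partial_{z^2}$ and $Q=4\,\mathrm{Im}\,\sigma=4y^1y^2y^3\,\partial_{y^1}\wedge\partial_{y^2}-\partial_{\theta_1}\wedge\partial_{\theta_2}$. Let $h=-\frac14\log(y^1y^2y^3)$, let $V=Q^{\#}dh=y^1(y^2-y^3)\partial_{y^1}+y^2(y^3-y^1)\partial_{y^2}$, where $Q^{\#}\alpha=Q(\cdot,\alpha)$, and let $\phi_t$ be the flow of $V$. For an endomorphism $I$ of the tangent bundle and a 1-form $\alpha$, $(I^*\alpha)(X)=\alpha(IX)$. In the composition $QF$, the 2-form acts by $X\mapsto F(\cdot,X)$ and the bivector by $\alpha\mapsto Q(\cdot,\alpha)$. The identities are understood where $\theta_1,\theta_2$ are defined (away from $y^1y^2y^3=0$). *)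

(* Defs.v *)
From Stdlib Require Import Reals ClassicalEpsilon.
From Coquelicot Require Import Coquelicot.
Open Scope R_scope.

(* The affine chart [z^3 <> 0] of CP^2, seen as a real normed space.  All
   tangent spaces are identified with C2 itself through this chart. *)
Definition C2 : NormedModule R_AbsRing :=
  prod_NormedModule R_AbsRing C_R_NormedModule C_R_NormedModule.

Definition z1 (p : C2) : C := fst p.
Definition z2 (p : C2) : C := snd p.

(* The locus y^1 y^2 y^3 <> 0 of CP^2. *)
Definition torus (p : C2) : Prop := z1 p <> 0%C /\ z2 p <> 0%C.

Definition covector : Type := C2 -> R.
Definition vector_field : Type := C2 -> C2.
Definition endo_field : Type := C2 -> C2 -> C2.
Definition one_form : Type := C2 -> covector.
Definition two_form : Type := C2 -> C2 -> C2 -> R.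

Definition dfun (f : C2 -> R) : one_form :=
  fun p X => Derive (fun s => f (plus p (scal s X))) 0.

Definition push (f : C2 -> C2) : endo_field := fun p X =>
  ((dfun (fun q => Re (z1 (f q))) p X,
    dfun (fun q => Im (z1 (f q))) p X),
   (dfun (fun q => Re (z2 (f q))) p X,
    dfun (fun q => Im (z2 (f q))) p X)).

Definition pull (f : C2 -> C2) (a : one_form) : one_form :=
  fun p X => a (f p) (push f p X).

(* d a (X, Y) = X (a Y) - Y (a X) for constant vector fields X, Y. *)
Definition ext_d (a : one_form) : two_form := fun p X Y =>
  dfun (fun q => a q Y) p X - dfun (fun q => a q X) p Y.

Definition wedge (a b : covector) (X Y : C2) : R := a X * b Y - a Y * b X.

(* (I^* a) (X) = a (I X) *)
Definition star (I : endo_field) (a : one_form) : one_form :=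
  fun p X => a p (I p X).

Definition inverse (f : C2 -> C2) (Y : C2) : C2 :=
  epsilon (inhabits Y) (fun X => f X = Y).

Definition I_minus : endo_field := fun _ X => (Ci * z1 X, Ci * z2 X)%C.

(* The conjugate of I_- by the push-forward: I_- acts at phi p. *)
Definition I_plus (phi : C2 -> C2) : endo_field := fun p X =>
  inverse (push phi p) (I_minus (phi p) (push phi p X)).

(* The values on d/dz^1 and d/dz^2 of the complex-linear extension of a real
   covector, where d/dz = (d/dx - i d/dy) / 2. *)
Definition on_dz1 (a : covector) : C :=
  (a (RtoC 1, RtoC 0) / 2, - a (Ci, RtoC 0) / 2).
Definition on_dz2 (a : covector) : C :=
  (a (RtoC 0, RtoC 1) / 2, - a (RtoC 0, Ci) / 2).

Definition sigma (p : C2) (a b : covector) : C :=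
  (Ci * z1 p * z2 p * (on_dz1 a * on_dz2 b - on_dz2 a * on_dz1 b))%C.

Definition Q (p : C2) (a b : covector) : R := 4 * Im (sigma p a b).

(* The vector Q(., a): its real coordinates are the pairings of Q(., a) with
   the real and imaginary parts of dz^1 and dz^2. *)
Definition Qsharp (p : C2) (a : covector) : C2 :=
  ((Q p (fun X => Re (z1 X)) a, Q p (fun X => Im (z1 X)) a),
   (Q p (fun X => Re (z2 X)) a, Q p (fun X => Im (z2 X)) a)).

(* The endomorphism QF, with F acting by X |-> F(., X) *)
Definition QF (F : two_form) : endo_field :=
  fun p X => Qsharp p (fun Y => F p Y X).

Definition y1 (p : C2) : R :=
  Cmod (z1 p) ^ 2 / (1 + Cmod (z1 p) ^ 2 + Cmod (z2 p) ^ 2).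
Definition y2 (p : C2) : R :=
  Cmod (z2 p) ^ 2 / (1 + Cmod (z1 p) ^ 2 + Cmod (z2 p) ^ 2).
Definition y3 (p : C2) : R := 1 - y1 p - y2 p.

Definition h (p : C2) : R := - (1 / 4) * ln (y1 p * y2 p * y3 p).

Definition V : vector_field := fun p => Qsharp p (dfun h p).

(* phi is the one-parameter group of C^1 diffeomorphisms of the open set U
   generated by W. *)
Record is_flow (U : C2 -> Prop) (W : vector_field) (phi : R -> C2 -> C2)
  : Prop := {
  flow_in : forall t p, U p -> U (phi t p);
  flow_0 : forall p, U p -> phi 0 p = p;
  flow_add : forall s t p, U p -> phi (s + t) p = phi s (phi t p);
  flow_derive : forall t p, U p ->
    is_derive (fun s : R => phi s p) t (W (phi t p));
  flow_diff : forall t p, U p -> ex_filterdiff (phi t) (locally p);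
  flow_C1 : forall t p X, U p -> continuous (fun q => push (phi t) q X) p
}.

(* int_0^T phi_t^* a dt; the integral is oriented, so T may be negative. *)
Definition int_pull (phi : R -> C2 -> C2) (T : R) (a : one_form) : one_form :=
  fun p X => RInt (fun t => pull (phi t) a p X) 0 T.

Definition F_form (phi : R -> C2 -> C2) (T : R) : two_form :=
  ext_d (int_pull phi T (star I_minus (dfun h))).

(* arg is a continuous branch of the argument near w. *)
Definition arg_branch (arg : C -> R) (w : C) : Prop :=
  locally (T := C_UniformSpace) w (fun z : C =>
    continuous (T := C_UniformSpace) arg z /\
    z = (RtoC (Cmod z) * (cos (arg z), sin (arg z)))%C).

(* Main.v *)
Require Import Defs.
From Corelib Require Import ssreflect.
From Stdlib Require Import Reals ClassicalEpsilon Lra.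
From Coquelicot Require Import Coquelicot.
Open Scope R_scope.

(** Write [z^a = exp (u_a + i theta_a)] on the torus. There
    [Q = d/du_1 /\ d/du_2 - d/dtheta_1 /\ d/dtheta_2] and [h] depends on the
    [u_a] only, so [V] is the Hamiltonian field
    [dh/du_2 d/du_1 - dh/du_1 d/du_2]: it moves the moduli and leaves the angles
    alone ([coord_V], [flow_coord]).

    Formula for [F]. As [I_-^* du_a = - dtheta_a], the pull-back
    [phi_t^* (I_-^* dh)] is
    [- dh/du_1 dtheta_1 - dh/du_2 dtheta_2
     = (du_2/dt) dtheta_1 - (du_1/dt) dtheta_2],
    with the derivatives taken along flow lines. Its time integral is therefore
    [G_2 dtheta_1 - G_1 dtheta_2], where [G_a = u_a o phi_T - u_a] is the drift
    ([int_pull_drift]), and [F = dG_2 /\ dtheta_1 - dG_1 /\ dtheta_2]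
    ([F_form_ddrift]). On the other hand
    [I_+^* dtheta_a = phi_T^* (I_-^* dtheta_a) = d(u_a o phi_T)], so
    [dG_a = I_+^* dtheta_a - I_-^* dtheta_a].

    Formula for [I_+ - I_-]. The moduli at time [T] are functions of the initial
    moduli only; this is uniqueness for the flow, obtained from a Gronwall
    estimate for the polynomial system satisfied by the [y^a]
    ([flow_y_unique]). In the frame [d/du_a], [d/dtheta_a] the differential of
    [phi_T] is thus block diagonal, with blocks the Jacobian matrix [K] of the
    moduli and the identity. Then [I_+ - I_-] has blocks [K - 1] and [1 - K^-1],
    while [- QF] has blocks [K - 1] and [1 - adj K]; they agree because
    [det K = 1], which is Liouville's theorem ([area_push]). *)

(** * Curves in the chart *)

Inductive axis := ax1 | ax2.

Definition coord (i : axis) (p : C2) : C :=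
  match i with ax1 => z1 p | ax2 => z2 p end.

(** Derivatives of curves in [C] are kept in real components, which is how [push]
    and the functions to be differentiated read them. *)
Definition c_derive (c : R -> C) (s : R) (v : C) : Prop :=
  is_derive (fun t => Re (c t)) s (Re v) /\
  is_derive (fun t => Im (c t)) s (Im v).

Lemma C2_ext (p q : C2) : (forall i, coord i p = coord i q) -> p = q.
Proof.
intros H. destruct p as [a b], q as [c d].
exact (f_equal2 pair (H ax1) (H ax2)).
Qed.

Lemma torus_coord (p : C2) : torus p <-> forall i, coord i p <> 0%C.
Proof.
split.
- intros [H1 H2] [|]; assumption.
- intros H; exact (conj (H ax1) (H ax2)).
Qed.

Lemma coord_plus (i : axis) (p q : C2) :
  coord i (plus p q) = (coord i p + coord i q)%C.
Proof. destruct i; reflexivity. Qed.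

Lemma coord_scal (i : axis) (s : R) (p : C2) :
  coord i (scal s p) = (RtoC s * coord i p)%C.
Proof.
assert (H : forall x y : R, (s * x, s * y) = (RtoC s * (x, y))%C)
  by (intros x y; unfold Cmult, RtoC; simpl; f_equal; ring).
destruct p as [[a b] [c d]]; destruct i; apply H.
Qed.

Lemma is_derive_linear {U W : NormedModule R_AbsRing} (l : U -> W) (g : R -> U)
  (s : R) (v : U) :
  is_linear l -> is_derive g s v -> is_derive (fun t => l (g t)) s (l v).
Proof.
intros Hl Hg.
apply filterdiff_ext_lin with (fun y : R => l (scal y v)).
- apply (filterdiff_comp' g l s (fun y : R => scal y v) l);
    [exact Hg | now apply filterdiff_linear].
- intros y. exact (linear_scal l Hl y v).
Qed.

Lemma c_derive_coord (i : axis) (g : R -> C2) (s : R) (v : C2) :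
  is_derive g s v -> c_derive (fun t => coord i (g t)) s (coord i v).
Proof.
intros Hg.
assert (Hc : is_derive (fun t => coord i (g t) : C_R_NormedModule) s (coord i v)).
{ destruct i.
  - exact (is_derive_linear _ g s v
      (is_linear_fst (U := C_R_NormedModule) (V := C_R_NormedModule)) Hg).
  - exact (is_derive_linear _ g s v
      (is_linear_snd (U := C_R_NormedModule) (V := C_R_NormedModule)) Hg). }
split.
- exact (is_derive_linear _ _ s _
    (is_linear_fst (U := R_NormedModule) (V := R_NormedModule)) Hc).
- exact (is_derive_linear _ _ s _
    (is_linear_snd (U := R_NormedModule) (V := R_NormedModule)) Hc).
Qed.

(** Writing the curve in the standard basis reduces it to scalar functions times
    constant vectors. *)
Lemma is_derive_C2 (g : R -> C2) (s : R) (v : C2) :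
  (forall i, c_derive (fun t => coord i (g t)) s (coord i v)) ->
  is_derive g s v.
Proof.
intros H. destruct (H ax1) as [H1 H2], (H ax2) as [H3 H4].
set (e1 := ((1, 0), (0, 0)) : C2). set (e2 := ((0, 1), (0, 0)) : C2).
set (e3 := ((0, 0), (1, 0)) : C2). set (e4 := ((0, 0), (0, 1)) : C2).
set (comb := fun a b c d : R =>
  plus (plus (scal a e1) (scal b e2)) (plus (scal c e3) (scal d e4)) : C2).
assert (E : forall q : C2,
  q = comb (Re (z1 q)) (Im (z1 q)) (Re (z2 q)) (Im (z2 q))).
{ intros [[a b] [c d]]. unfold comb, z1, z2; simpl.
  change (((a, b), (c, d)) =
    ((a * 1 + b * 0 + (c * 0 + d * 0), a * 0 + b * 1 + (c * 0 + d * 0)),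
     (a * 0 + b * 0 + (c * 1 + d * 0), a * 0 + b * 0 + (c * 0 + d * 1)))).
  f_equal; f_equal; ring. }
rewrite (E v).
apply is_derive_ext with
  (fun t => comb (Re (z1 (g t))) (Im (z1 (g t))) (Re (z2 (g t))) (Im (z2 (g t)))).
{ intros t; symmetry; apply E. }
unfold comb.
apply: is_derive_plus; apply: is_derive_plus; apply: is_derive_scal_l; assumption.
Qed.

Lemma c_derive_unique (c : R -> C) (s : R) (v w : C) :
  c_derive c s v -> c_derive c s w -> v = w.
Proof.
intros [H1 H2] [H3 H4].
apply is_derive_unique in H1, H2, H3, H4.
destruct v, w; simpl in *; congruence.
Qed.

Lemma c_derive_ext_loc (c d : R -> C) (s : R) (v : C) :
  locally s (fun t => c t = d t) -> c_derive c s v -> c_derive d s v.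
Proof.
intros L [H1 H2]; split.
- apply is_derive_ext_loc with (2 := H1).
  apply: filter_imp L => t Ht; now rewrite Ht.
- apply is_derive_ext_loc with (2 := H2).
  apply: filter_imp L => t Ht; now rewrite Ht.
Qed.

Lemma c_derive_scal (f : R -> R) (c : R -> C) (s a : R) (v : C) :
  is_derive f s a -> c_derive c s v ->
  c_derive (fun t => (RtoC (f t) * c t)%C) s (RtoC (f s) * v + RtoC a * c s)%C.
Proof.
intros Hf [H1 H2]; split; simpl.
- apply is_derive_ext with (fun t => f t * Re (c t)).
  { intros t; unfold Re, Im; simpl; ring. }
  evar_last; [apply: is_derive_mult; [exact Hf | exact H1 | intros; apply: Rmult_comm] |].
  unfold plus, mult; simpl; unfold Re, Im; simpl; ring.
- apply is_derive_ext with (fun t => f t * Im (c t)).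
  { intros t; unfold Re, Im; simpl; ring. }
  evar_last; [apply: is_derive_mult; [exact Hf | exact H2 | intros; apply: Rmult_comm] |].
  unfold plus, mult; simpl; unfold Re, Im; simpl; ring.
Qed.

Lemma C_neq0_norm2 (c : C) : c <> 0%C -> 0 < Re c ^ 2 + Im c ^ 2.
Proof.
intros Hc. destruct c as [a b]; simpl.
assert (~ (a = 0 /\ b = 0)) by (intros [-> ->]; now apply Hc).
destruct (Req_dec a 0) as [-> | Ha]; [| nra].
destruct (Req_dec b 0) as [-> | Hb]; [tauto | nra].
Qed.

Lemma is_derive_ln_Cmod (c : R -> C) (s : R) (v : C) :
  c s <> 0%C -> c_derive c s v ->
  is_derive (fun t => ln (Cmod (c t))) s (Re (v / c s)%C).
Proof.
intros Hc [H1 H2].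
assert (H0 := C_neq0_norm2 _ Hc).
assert (E : forall t, Cmod (c t) = sqrt (Re (c t) ^ 2 + Im (c t) ^ 2))
  by reflexivity.
apply is_derive_ext with (fun t => ln (sqrt (Re (c t) ^ 2 + Im (c t) ^ 2))).
{ reflexivity. }
set (a := fun t => Re (c t)) in *. set (b := fun t => Im (c t)) in *.
change (is_derive (fun t => ln (sqrt (a t ^ 2 + b t ^ 2))) s (Re (v / c s)%C)).
change (0 < a s ^ 2 + b s ^ 2) in H0.
assert (Hs : 0 < sqrt (a s ^ 2 + b s ^ 2)) by now apply sqrt_lt_R0.
auto_derive.
- split; [now exists (Re v) |]. split; [now exists (Im v) |].
  simpl in *. split; [exact H0 |]. split; [exact Hs | exact I].
- assert (E1 : Derive (fun x => a x) s = Re v) by now apply is_derive_unique.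
  assert (E2 : Derive (fun x => b x) s = Im v) by now apply is_derive_unique.
  rewrite E1 E2.
  replace (a s * (a s * 1) + b s * (b s * 1)) with
    (sqrt (a s ^ 2 + b s ^ 2) * sqrt (a s ^ 2 + b s ^ 2))
    by (rewrite sqrt_sqrt; [ring | lra]).
  rewrite sqrt_square; [| lra].
  transitivity ((a s * Re v + b s * Im v) / (sqrt (a s ^ 2 + b s ^ 2) * sqrt (a s ^ 2 + b s ^ 2))).
  + field; lra.
  + rewrite sqrt_sqrt; [| lra]. unfold a, b in *.
    destruct v, (c s); simpl in *. field. lra.
Qed.

Lemma c_derive_continuous (c : R -> C) (s : R) (v : C) :
  c_derive c s v -> continuous (fun t => Cmod (c t)) s.
Proof.
intros [H1 H2].
set (a := fun t => Re (c t)) in *. set (b := fun t => Im (c t)) in *.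
apply (continuous_comp (fun t => a t ^ 2 + b t ^ 2) sqrt).
- apply (ex_derive_continuous (V := R_NormedModule)
    (fun t => a t ^ 2 + b t ^ 2)).
  auto_derive. repeat split; eexists; eassumption.
- apply continuous_sqrt.
Qed.

Lemma torus_locally (g : R -> C2) (s : R) (v : C2) :
  torus (g s) -> is_derive g s v -> locally s (fun t => torus (g t)).
Proof.
intros Ht Hg.
assert (L : forall i, locally s (fun t => 0 < Cmod (coord i (g t)))).
{ intros i.
  apply (c_derive_continuous _ _ _ (c_derive_coord i g s v Hg)
           (fun r => 0 < r)).
  apply (open_gt 0), Cmod_gt_0. now apply (proj1 (torus_coord _)). }
generalize (filter_and _ _ (L ax1) (L ax2)).
apply filter_imp. intros t [Ht1 Ht2].
split; apply Cmod_gt_0; assumption.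
Qed.

Lemma is_derive_line (p X : C2) (s : R) :
  is_derive (fun t : R => plus p (scal t X)) s X.
Proof.
evar_last.
- apply: is_derive_plus; [apply is_derive_const |].
  apply: is_derive_scal_l. apply is_derive_id.
- rewrite plus_zero_l. exact (scal_one X).
Qed.

Lemma line_0 (p X : C2) : plus p (scal 0 X) = p.
Proof. rewrite (scal_zero_l X). apply plus_zero_r. Qed.

(** The line in the definition of [dfun] may be treated as an arbitrary curve, so
    that the chain rule along curves is the only rule needed. *)
Lemma dfun_value (f : C2 -> R) (p X : C2) (l : R) :
  (forall g : R -> C2, g 0 = p -> is_derive g 0 X ->
     is_derive (fun t => f (g t)) 0 l) -> dfun f p X = l.
Proof.
intros H. apply is_derive_unique.
apply (H (fun t => plus p (scal t X))).
- apply line_0.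
- apply is_derive_line.
Qed.

Lemma push_value (f : C2 -> C2) (p X Y : C2) :
  is_derive (fun s => f (plus p (scal s X))) 0 Y -> push f p X = Y.
Proof.
intros H.
pose proof (c_derive_coord ax1 _ _ _ H) as [H1 H2].
pose proof (c_derive_coord ax2 _ _ _ H) as [H3 H4].
apply is_derive_unique in H1, H2, H3, H4.
destruct Y as [[a b] [c d]].
exact (f_equal2 pair (f_equal2 pair H1 H2) (f_equal2 pair H3 H4)).
Qed.

(** The directional derivatives that make up [push] are the values of one
    linear map, which the chain rule then applies to every curve. *)
Lemma push_linear (f : C2 -> C2) (p : C2) :
  ex_filterdiff f (locally p) -> filterdiff f (locally p) (push f p).
Proof.
intros [L HL].
apply filterdiff_ext_lin with (1 := HL).
intros X. symmetry. apply push_value.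
apply filterdiff_ext_lin with (fun y : R => L (scal y X)).
- apply (filterdiff_comp' (fun t : R => plus p (scal t X)) f 0).
  + apply is_derive_line.
  + now rewrite line_0.
- intros y. exact (linear_scal L (proj1 HL) y X).
Qed.

Lemma is_derive_push (f : C2 -> C2) (g : R -> C2) (s : R) (X : C2) :
  ex_filterdiff f (locally (g s)) -> is_derive g s X ->
  is_derive (fun t => f (g t)) s (push f (g s) X).
Proof.
intros Hf Hg. apply push_linear in Hf.
apply filterdiff_ext_lin with (fun y : R => push f (g s) (scal y X)).
- now apply (filterdiff_comp' g f s (fun y : R => scal y X) (push f (g s))).
- intros y. exact (linear_scal _ (proj1 Hf) y X).
Qed.

(** * Logarithmic coordinates *)

(** The value of [d log z^i = du_i + i dtheta_i] on [X]. *)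
Definition xi (i : axis) (p X : C2) : C := (coord i X / coord i p)%C.

Definition u (i : axis) (p : C2) : R := ln (Cmod (coord i p)).

Lemma coord_xi (i : axis) (p X : C2) :
  torus p -> coord i X = (coord i p * xi i p X)%C.
Proof.
intros Hp. unfold xi. field. now apply (proj1 (torus_coord p)).
Qed.

Lemma xi_ext (p X Y : C2) :
  torus p -> (forall i, xi i p X = xi i p Y) -> X = Y.
Proof.
intros Hp H. apply C2_ext. intros i.
now rewrite (coord_xi i p X Hp) (coord_xi i p Y Hp) H.
Qed.

Lemma xi_plus (i : axis) (p X Y : C2) :
  xi i p (plus X Y) = (xi i p X + xi i p Y)%C.
Proof. unfold xi. rewrite coord_plus. unfold Cdiv. ring. Qed.

Lemma xi_scal (i : axis) (p X : C2) (s : R) :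
  xi i p (scal s X) = (RtoC s * xi i p X)%C.
Proof. unfold xi. rewrite coord_scal. unfold Cdiv. ring. Qed.

Lemma exp_u (i : axis) (p : C2) : torus p -> exp (u i p) = Cmod (coord i p).
Proof.
intros Hp. apply exp_ln, Cmod_gt_0. now apply (proj1 (torus_coord p)).
Qed.

Lemma exp_2u (i : axis) (p : C2) :
  torus p -> exp (2 * u i p) = Cmod (coord i p) ^ 2.
Proof.
intros Hp. rewrite <- (exp_u i p Hp).
replace (2 * u i p) with (u i p + u i p) by ring.
rewrite exp_plus. ring.
Qed.

Lemma is_derive_u (i : axis) (g : R -> C2) (s : R) (X : C2) :
  torus (g s) -> is_derive g s X ->
  is_derive (fun t => u i (g t)) s (Re (xi i (g s) X)).
Proof.
intros Ht Hg. apply (is_derive_ln_Cmod (fun t => coord i (g t))).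
- now apply (proj1 (torus_coord (g s))).
- now apply c_derive_coord.
Qed.

(** With [z^a = exp (u_a + i theta_a)], the holomorphic bivector [sigma] is
    [i d/d(log z^1) /\ d/d(log z^2)]; the real covector with complex
    coefficients [A1], [A2] is therefore sent to [A2], [- A1]. *)
Lemma Qsharp_log (p : C2) (a : covector) (A1 A2 : C) :
  torus p ->
  (forall X, a X = Re (A1 * xi ax1 p X + A2 * xi ax2 p X)%C) ->
  Qsharp p a = ((z1 p * A2)%C, (- (z2 p * A1))%C).
Proof.
intros [Hp1 Hp2] Ha.
assert (D : forall x y : C, a (x, y) = Re (A1 / z1 p * x + A2 / z2 p * y)%C).
{ intros x y. rewrite Ha. f_equal. unfold xi.
  change ((A1 * (x / z1 p) + A2 * (y / z2 p) =
           A1 / z1 p * x + A2 / z2 p * y)%C).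
  field. repeat split; assumption. }
assert (H2 : (/ 2)%C = ((/ 2)%R, 0%R)).
{ unfold Cinv, RtoC; simpl. f_equal; field. }
assert (N2 : RtoC 2 <> 0%C) by (intros H; injection H; lra).
assert (E1 : on_dz1 a = (A1 / (2 * z1 p))%C).
{ transitivity ((A1 / z1 p) * / 2)%C.
  - rewrite H2. unfold on_dz1. rewrite !D.
    destruct (A1 / z1 p)%C, (A2 / z2 p)%C.
    unfold Cmult, Cplus, Ci, RtoC, Re; simpl. f_equal; field.
  - field. repeat split; assumption. }
assert (E2 : on_dz2 a = (A2 / (2 * z2 p))%C).
{ transitivity ((A2 / z2 p) * / 2)%C.
  - rewrite H2. unfold on_dz2. rewrite !D.
    destruct (A1 / z1 p)%C, (A2 / z2 p)%C.
    unfold Cmult, Cplus, Ci, RtoC, Re; simpl. f_equal; field.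
  - field. repeat split; assumption. }
assert (Es : forall b : covector, Defs.sigma p b a =
  (Ci * / 2 * (on_dz1 b * (z1 p * A2) - on_dz2 b * (z2 p * A1)))%C).
{ intros b. unfold Defs.sigma. rewrite E1 E2. field. repeat split; assumption. }
rewrite H2 in Es.
unfold Qsharp, Q. rewrite !Es. unfold on_dz1, on_dz2.
destruct (z1 p * A2)%C as [b c], (z2 p * A1)%C as [d e].
unfold z1, z2; simpl. unfold Copp, Cmult, Cminus, Cplus, Ci, RtoC, Re, Im; simpl.
f_equal; f_equal; field.
Qed.

(** The components [dh/du_2] and [- dh/du_1] of [V]. *)
Definition rate (i : axis) (p : C2) : R :=
  match i with
  | ax1 => - (1 / 2) + 3 / 2 * y2 p
  | ax2 => 1 / 2 - 3 / 2 * y1 p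
  end.

Lemma y1_u (p : C2) : torus p ->
  y1 p = exp (2 * u ax1 p) / (1 + exp (2 * u ax1 p) + exp (2 * u ax2 p)).
Proof. intros Hp. now rewrite !exp_2u. Qed.

Lemma y2_u (p : C2) : torus p ->
  y2 p = exp (2 * u ax2 p) / (1 + exp (2 * u ax1 p) + exp (2 * u ax2 p)).
Proof. intros Hp. now rewrite !exp_2u. Qed.

Lemma h_u (p : C2) : torus p ->
  h p = - (u ax1 p + u ax2 p) / 2
        + 3 / 4 * ln (1 + exp (2 * u ax1 p) + exp (2 * u ax2 p)).
Proof.
intros Hp. unfold h, y3. rewrite (y1_u p Hp) (y2_u p Hp).
set (a := u ax1 p). set (b := u ax2 p).
assert (Ha := exp_pos (2 * a)). assert (Hb := exp_pos (2 * b)).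
set (S := 1 + exp (2 * a) + exp (2 * b)).
assert (HS : 0 < S) by (unfold S; lra).
replace (exp (2 * a) / S * (exp (2 * b) / S) *
  (1 - exp (2 * a) / S - exp (2 * b) / S))
  with (exp (2 * a) * exp (2 * b) * (/ S * / S * / S)).
2:{ replace (1 - exp (2 * a) / S - exp (2 * b) / S) with (/ S).
    - field. lra.
    - unfold S. field. fold S. lra. }
assert (Hi := Rinv_0_lt_compat _ HS).
rewrite !ln_mult; try assumption; repeat apply Rmult_lt_0_compat; try assumption.
rewrite !ln_exp ln_Rinv; [| assumption]. unfold S; field.
Qed.

Lemma is_derive_h (g : R -> C2) (s : R) (X : C2) :
  torus (g s) -> is_derive g s X ->
  is_derive (fun t => h (g t)) s
    (- rate ax2 (g s) * Re (xi ax1 (g s) X)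
     + rate ax1 (g s) * Re (xi ax2 (g s) X)).
Proof.
intros Ht Hg.
assert (H1 := is_derive_u ax1 g s X Ht Hg).
assert (H2 := is_derive_u ax2 g s X Ht Hg).
apply is_derive_ext_loc with (fun t => - (u ax1 (g t) + u ax2 (g t)) / 2
  + 3 / 4 * ln (1 + exp (2 * u ax1 (g t)) + exp (2 * u ax2 (g t)))).
{ generalize (torus_locally g s X Ht Hg). apply filter_imp.
  intros t Hgt. symmetry. now apply h_u. }
unfold rate. rewrite (y1_u _ Ht) (y2_u _ Ht).
set (a := fun t => u ax1 (g t)) in *. set (b := fun t => u ax2 (g t)) in *.
change (is_derive (fun t => - (a t + b t) / 2
  + 3 / 4 * ln (1 + exp (2 * a t) + exp (2 * b t))) s
  (- (1 / 2 - 3 / 2 * (exp (2 * a s) / (1 + exp (2 * a s) + exp (2 * b s))))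
     * Re (xi ax1 (g s) X) +
   (- (1 / 2) + 3 / 2 * (exp (2 * b s) / (1 + exp (2 * a s) + exp (2 * b s))))
     * Re (xi ax2 (g s) X))).
assert (Ha := exp_pos (2 * a s)). assert (Hb := exp_pos (2 * b s)).
auto_derive.
- repeat split; try (eexists; eassumption). lra.
- assert (E1 := is_derive_unique _ _ _ H1). assert (E2 := is_derive_unique _ _ _ H2).
  change (fun x : R => a x) with a. change (fun x : R => b x) with b.
  rewrite E1 E2. field. lra.
Qed.

Lemma is_derive_y1 (g : R -> C2) (s : R) (X : C2) :
  torus (g s) -> is_derive g s X ->
  is_derive (fun t => y1 (g t)) s
    (2 * y1 (g s) * ((1 - y1 (g s)) * Re (xi ax1 (g s) X)
                     - y2 (g s) * Re (xi ax2 (g s) X))).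
Proof.
intros Ht Hg.
assert (H1 := is_derive_u ax1 g s X Ht Hg).
assert (H2 := is_derive_u ax2 g s X Ht Hg).
apply is_derive_ext_loc with (fun t => exp (2 * u ax1 (g t)) /
  (1 + exp (2 * u ax1 (g t)) + exp (2 * u ax2 (g t)))).
{ generalize (torus_locally g s X Ht Hg). apply filter_imp.
  intros t Hgt. symmetry. now apply y1_u. }
rewrite (y1_u _ Ht) (y2_u _ Ht).
set (a := fun t => u ax1 (g t)) in *. set (b := fun t => u ax2 (g t)) in *.
change (u ax1 (g s)) with (a s). change (u ax2 (g s)) with (b s).
change (is_derive (fun t => exp (2 * a t) / (1 + exp (2 * a t) + exp (2 * b t))) s
  (2 * (exp (2 * a s) / (1 + exp (2 * a s) + exp (2 * b s))) *
   ((1 - exp (2 * a s) / (1 + exp (2 * a s) + exp (2 * b s))) *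
    Re (xi ax1 (g s) X) -
    exp (2 * b s) / (1 + exp (2 * a s) + exp (2 * b s)) *
    Re (xi ax2 (g s) X)))).
assert (Ha := exp_pos (2 * a s)). assert (Hb := exp_pos (2 * b s)).
auto_derive.
- repeat split; try (eexists; eassumption). lra.
- assert (E1 := is_derive_unique _ _ _ H1). assert (E2 := is_derive_unique _ _ _ H2).
  change (fun x : R => a x) with a. change (fun x : R => b x) with b.
  rewrite E1 E2. field. lra.
Qed.

Lemma is_derive_y2 (g : R -> C2) (s : R) (X : C2) :
  torus (g s) -> is_derive g s X ->
  is_derive (fun t => y2 (g t)) s
    (2 * y2 (g s) * ((1 - y2 (g s)) * Re (xi ax2 (g s) X)
                     - y1 (g s) * Re (xi ax1 (g s) X))).
Proof.
intros Ht Hg.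
assert (H1 := is_derive_u ax1 g s X Ht Hg).
assert (H2 := is_derive_u ax2 g s X Ht Hg).
apply is_derive_ext_loc with (fun t => exp (2 * u ax2 (g t)) /
  (1 + exp (2 * u ax1 (g t)) + exp (2 * u ax2 (g t)))).
{ generalize (torus_locally g s X Ht Hg). apply filter_imp.
  intros t Hgt. symmetry. now apply y2_u. }
rewrite (y1_u _ Ht) (y2_u _ Ht).
set (a := fun t => u ax1 (g t)) in *. set (b := fun t => u ax2 (g t)) in *.
change (is_derive (fun t => exp (2 * b t) / (1 + exp (2 * a t) + exp (2 * b t))) s
  (2 * (exp (2 * b s) / (1 + exp (2 * a s) + exp (2 * b s))) *
   ((1 - exp (2 * b s) / (1 + exp (2 * a s) + exp (2 * b s))) *
    Re (xi ax2 (g s) X) -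
    exp (2 * a s) / (1 + exp (2 * a s) + exp (2 * b s)) *
    Re (xi ax1 (g s) X)))).
assert (Ha := exp_pos (2 * a s)). assert (Hb := exp_pos (2 * b s)).
auto_derive.
- repeat split; try (eexists; eassumption). lra.
- assert (E1 := is_derive_unique _ _ _ H1). assert (E2 := is_derive_unique _ _ _ H2).
  change (fun x : R => a x) with a. change (fun x : R => b x) with b.
  rewrite E1 E2. field. lra.
Qed.

Lemma dfun_h (p X : C2) : torus p ->
  dfun h p X = - rate ax2 p * Re (xi ax1 p X) + rate ax1 p * Re (xi ax2 p X).
Proof.
intros Hp. apply dfun_value. intros g Hg Hd.
rewrite <- Hg in Hp |- *. now apply is_derive_h.
Qed.

(** [V] multiplies each coordinate by a real number: the flow moves the moduli
    only, by the Hamiltonian system of [h] for [du_1 /\ du_2]. *)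
Lemma coord_V (i : axis) (p : C2) :
  torus p -> coord i (V p) = (coord i p * RtoC (rate i p))%C.
Proof.
intros Hp. unfold V.
rewrite (Qsharp_log p _ (RtoC (- rate ax2 p)) (RtoC (rate ax1 p)) Hp).
- destruct i; [reflexivity |]. change (coord ax2 p) with (z2 p).
  change (- (z2 p * RtoC (- rate ax2 p)) = z2 p * RtoC (rate ax2 p))%C.
  rewrite RtoC_opp. ring.
- intros X. rewrite (dfun_h p X Hp).
  destruct (xi ax1 p X), (xi ax2 p X); simpl. ring.
Qed.

Lemma xi_V (i : axis) (p : C2) : torus p -> xi i p (V p) = RtoC (rate i p).
Proof.
intros Hp. unfold xi. rewrite coord_V; [| assumption]. field.
now apply (proj1 (torus_coord p)).
Qed.

(** * The flow *)

Lemma constant_of_derive_0 (f : R -> R) :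
  (forall t, is_derive f t 0) -> forall s t, f s = f t.
Proof.
intros H.
assert (L : forall s t, s < t -> f s = f t).
{ intros s t Hst. apply (eq_is_derive f s t); [| exact Hst].
  intros r _. apply H. }
intros s t. destruct (Rtotal_order s t) as [Hl | [-> | Hl]].
- now apply L.
- reflexivity.
- symmetry. now apply L.
Qed.

Lemma flow_u (phi : R -> C2 -> C2) (i : axis) (t : R) (p : C2) :
  is_flow torus V phi -> torus p ->
  is_derive (fun s => u i (phi s p)) t (rate i (phi t p)).
Proof.
intros Hf Hp.
evar_last.
- apply (is_derive_u i (fun s => phi s p)).
  + now apply (flow_in _ _ _ Hf).
  + now apply (flow_derive _ _ _ Hf).
- rewrite xi_V; [| now apply (flow_in _ _ _ Hf)]. reflexivity.
Qed.

Lemma flow_h (phi : R -> C2 -> C2) (t : R) (p : C2) :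
  is_flow torus V phi -> torus p -> h (phi t p) = h p.
Proof.
intros Hf Hp. rewrite <- (flow_0 _ _ _ Hf p Hp) at 2.
apply (constant_of_derive_0 (fun s => h (phi s p))). intros s.
assert (Hs := flow_in _ _ _ Hf s p Hp).
evar_last.
- apply (is_derive_h (fun s => phi s p)); [exact Hs |].
  now apply (flow_derive _ _ _ Hf).
- rewrite !xi_V; try exact Hs. simpl. ring.
Qed.

Definition drift (f : C2 -> C2) (i : axis) (p : C2) : R := u i (f p) - u i p.

(** The real factor that [V] puts on each coordinate integrates to a positive
    factor, so the angles stay fixed. *)
Lemma flow_coord (phi : R -> C2 -> C2) (i : axis) (t : R) (p : C2) :
  is_flow torus V phi -> torus p ->
  coord i (phi t p) = (RtoC (exp (drift (phi t) i p)) * coord i p)%C.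
Proof.
intros Hf Hp.
set (w := fun s => (RtoC (exp (- drift (phi s) i p)) * coord i (phi s p))%C).
assert (Hw : forall s, c_derive w s 0%C).
{ intros s. assert (Hs := flow_in _ _ _ Hf s p Hp).
  assert (Hu := flow_u phi i s p Hf Hp).
  unfold w. evar_last.
  - apply c_derive_scal.
    + instantiate (1 := - rate i (phi s p) * exp (- drift (phi s) i p)).
      unfold drift. set (a := fun r => u i (phi r p)) in *.
      change (is_derive (fun r => exp (- (a r - u i p))) s
        (- rate i (phi s p) * exp (- (a s - u i p)))).
      auto_derive; [eexists; exact Hu |].
      rewrite (is_derive_unique _ _ _ Hu). unfold Rminus. ring.
    + apply c_derive_coord, (flow_derive _ _ _ Hf s p Hp).
  - rewrite coord_V; [| exact Hs]. rewrite RtoC_mult RtoC_opp. ring. }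
assert (E : w t = w 0).
{ assert (E1 : Re (w t) = Re (w 0)).
  { apply (constant_of_derive_0 (fun s => Re (w s))). intros s. apply (Hw s). }
  assert (E2 : Im (w t) = Im (w 0)).
  { apply (constant_of_derive_0 (fun s => Im (w s))). intros s. apply (Hw s). }
  destruct (w t), (w 0); simpl in *; congruence. }
assert (E0 : w 0 = coord i p).
{ unfold w, drift. rewrite (flow_0 _ _ _ Hf p Hp).
  replace (- (u i p - u i p)) with 0 by ring. rewrite exp_0. ring. }
rewrite <- E0, <- E. unfold w. rewrite Cmult_assoc.
rewrite <- RtoC_mult, <- exp_plus, Rplus_opp_r, exp_0. ring.
Qed.

Lemma y_bounds (p : C2) : 0 <= y1 p <= 1 /\ 0 <= y2 p <= 1.
Proof.
unfold y1, y2.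
assert (H1 := pow2_ge_0 (Cmod (z1 p))). assert (H2 := pow2_ge_0 (Cmod (z2 p))).
set (a := Cmod (z1 p) ^ 2) in *. set (b := Cmod (z2 p) ^ 2) in *.
assert (Hi : 0 < / (1 + a + b)) by (apply Rinv_0_lt_compat; lra).
assert (E : (1 + a + b) * / (1 + a + b) = 1) by (apply Rinv_r; lra).
unfold Rdiv. set (r := / (1 + a + b)) in *.
repeat split; nra.
Qed.

(** This system is polynomial on a bounded region, so its Lipschitz estimate is
    elementary. *)
Lemma flow_y (phi : R -> C2 -> C2) (t : R) (p : C2) :
  is_flow torus V phi -> torus p ->
  is_derive (fun s => y1 (phi s p)) t
    (y1 (phi t p) * (y1 (phi t p) + 2 * y2 (phi t p) - 1)) /\
  is_derive (fun s => y2 (phi s p)) t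
    (y2 (phi t p) * (1 - 2 * y1 (phi t p) - y2 (phi t p))).
Proof.
intros Hf Hp. assert (Ht := flow_in _ _ _ Hf t p Hp).
assert (Hd := flow_derive _ _ _ Hf t p Hp).
split; evar_last.
- apply (is_derive_y1 (fun s => phi s p)); eassumption.
- rewrite !xi_V; try exact Ht. simpl. field.
- apply (is_derive_y2 (fun s => phi s p)); eassumption.
- rewrite !xi_V; try exact Ht. simpl. field.
Qed.

Lemma nondecreasing_of_derive (f df : R -> R) :
  (forall t, is_derive f t (df t)) -> (forall t, 0 <= df t) ->
  forall s t, s <= t -> f s <= f t.
Proof.
intros Hf Hd s t Hst.
destruct (MVT_gen f s t df) as [c [_ Hc]].
- intros; apply Hf.
- intros. apply derivable_continuous_pt. exists (df x).
  now apply is_derive_Reals.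
- assert (H := Hd c). nra.
Qed.

(** [E t * exp (- k t)] decreases and [E t * exp (k t)] increases, which settles
    positive and negative times respectively. *)
Lemma gronwall_zero (E dE : R -> R) (k : R) :
  (forall t, is_derive E t (dE t)) ->
  (forall t, Rabs (dE t) <= k * E t) -> E 0 = 0 ->
  forall t, E t <= 0.
Proof.
intros HE Hb H0 t.
assert (Hd : forall c r, is_derive (fun t => E t * exp (c * t)) r
    ((dE r + c * E r) * exp (c * r))).
{ intros c r. auto_derive; [eexists; apply HE |].
  rewrite (is_derive_unique _ _ _ (HE r)). ring. }
assert (He := fun r => exp_pos r).
destruct (Rle_or_lt t 0) as [Ht | Ht].
- assert (H := nondecreasing_of_derive _ _ (Hd k)).
  assert (E t * exp (k * t) <= E 0 * exp (k * 0)).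
  { apply H; [| exact Ht]. intros r. apply Rmult_le_pos; [| apply Rlt_le, He].
    generalize (Hb r) (Rle_abs (- dE r)). rewrite Rabs_Ropp. lra. }
  rewrite H0 in H1. generalize (He (k * t)). nra.
- assert (H : - (E 0 * exp (- k * 0)) <= - (E t * exp (- k * t))).
  { apply (nondecreasing_of_derive (fun r => - (E r * exp (- k * r)))
      (fun r => - ((dE r + - k * E r) * exp (- k * r)))); [| | lra].
    - intros r. apply (is_derive_opp (fun r => E r * exp (- k * r))). apply Hd.
    - intros r. rewrite Ropp_mult_distr_l.
      apply Rmult_le_pos; [| apply Rlt_le, He].
      generalize (Hb r) (Rle_abs (dE r)). lra. }
  rewrite H0 in H. generalize (He (- k * t)). nra.
Qed.

(** Uniqueness for the system of the [y^a]: the flow of the moduli does not see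
    the angles. *)
Lemma flow_y_unique (phi : R -> C2 -> C2) (p q : C2) (t : R) :
  is_flow torus V phi -> torus p -> torus q ->
  (forall i, Cmod (coord i p) = Cmod (coord i q)) ->
  y1 (phi t p) = y1 (phi t q) /\ y2 (phi t p) = y2 (phi t q).
Proof.
intros Hf Hp Hq Hpq.
set (a := fun s => y1 (phi s p)). set (b := fun s => y2 (phi s p)).
set (c := fun s => y1 (phi s q)). set (d := fun s => y2 (phi s q)).
set (f1 := fun x y : R => x * (x + 2 * y - 1)).
set (f2 := fun x y : R => y * (1 - 2 * x - y)).
assert (HE : (a t - c t) ^ 2 + (b t - d t) ^ 2 <= 0).
{ apply (gronwall_zero (fun s => (a s - c s) ^ 2 + (b s - d s) ^ 2)
    (fun s => 2 * (a s - c s) * (f1 (a s) (b s) - f1 (c s) (d s))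
            + 2 * (b s - d s) * (f2 (a s) (b s) - f2 (c s) (d s))) 8).
  - intros s. destruct (flow_y phi s p Hf Hp) as [Ha Hb].
    destruct (flow_y phi s q Hf Hq) as [Hc Hd].
    auto_derive; [repeat split; eexists; eassumption |].
    apply is_derive_unique in Ha, Hb, Hc, Hd.
    change (fun x : R => a x) with a. change (fun x : R => b x) with b.
    change (fun x : R => c x) with c. change (fun x : R => d x) with d.
    rewrite Ha Hb Hc Hd.
    fold (a s) (b s) (c s) (d s). unfold f1, f2. ring.
  - intros s. destruct (y_bounds (phi s p)) as [Ha Hb].
    destruct (y_bounds (phi s q)) as [Hc Hd].
    fold (a s) in Ha. fold (b s) in Hb. fold (c s) in Hc. fold (d s) in Hd.
    generalize dependent (a s). generalize dependent (b s).
    generalize dependent (c s). generalize dependent (d s).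
    intros y Hy x Hx y' Hy' x' Hx'. unfold f1, f2.
    set (v := x' - x). set (w := y' - y).
    (* The coefficients of the squares are at most 3 in absolute value, and
       [2 v w] is at most [v^2 + w^2]; hence the constant 2 * (3 + 1) = 8. *)
    replace (2 * v * (x' * (x' + 2 * y' - 1) - x * (x + 2 * y - 1)) +
             2 * w * (y' * (1 - 2 * x' - y') - y * (1 - 2 * x - y)))
      with (2 * ((x' + 2 * y' - 1 + x) * v ^ 2 + (1 - 2 * x' - y' - y) * w ^ 2
                 + (x - y) * (2 * v * w))) by (unfold v, w; ring).
    assert (Hv := pow2_ge_0 v). assert (Hw := pow2_ge_0 w).
    assert (H1 := pow2_ge_0 (v + w)). assert (H2 := pow2_ge_0 (v - w)).
    assert (Hm : - (v ^ 2 + w ^ 2) <= 2 * v * w <= v ^ 2 + w ^ 2) by nra.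
    assert (HA : - 3 <= x' + 2 * y' - 1 + x <= 3) by lra.
    assert (HB : - 3 <= 1 - 2 * x' - y' - y <= 3) by lra.
    assert (HC : - 1 <= x - y <= 1) by lra.
    apply Rabs_le. clear - Hv Hw Hm HA HB HC.
    revert Hv Hw Hm HA HB HC.
    generalize (x' + 2 * y' - 1 + x) (1 - 2 * x' - y' - y) (x - y)
      (v ^ 2) (w ^ 2) (2 * v * w).
    intros A B C a b m Ha Hb Hm HA HB HC.
    assert (- 3 * a <= A * a <= 3 * a) by nra.
    assert (- 3 * b <= B * b <= 3 * b) by nra.
    assert (Hc : 0 <= (1 - C) * (a + b + m)) by (apply Rmult_le_pos; lra).
    assert (Hd : 0 <= (1 + C) * (a + b - m)) by (apply Rmult_le_pos; lra).
    assert (He : 0 <= (1 - C) * (a + b - m)) by (apply Rmult_le_pos; lra).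
    assert (Hf : 0 <= (1 + C) * (a + b + m)) by (apply Rmult_le_pos; lra).
    assert (- (a + b) <= C * m <= a + b) by (split; lra).
    lra.
  - unfold a, b, c, d. rewrite !(flow_0 _ _ _ Hf); try assumption.
    unfold y1, y2. change (z1 p) with (coord ax1 p).
    change (z2 p) with (coord ax2 p). rewrite !Hpq. unfold coord. ring. }
assert (H1 := pow2_ge_0 (a t - c t)). assert (H2 := pow2_ge_0 (b t - d t)).
fold (a t) (b t) (c t) (d t).
split; apply Rminus_diag_uniq, Rsqr_0_uniq; unfold Rsqr; lra.
Qed.

Lemma flow_u_unique (phi : R -> C2 -> C2) (p q : C2) (t : R) (i : axis) :
  is_flow torus V phi -> torus p -> torus q ->
  (forall i, Cmod (coord i p) = Cmod (coord i q)) ->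
  u i (phi t p) = u i (phi t q).
Proof.
intros Hf Hp Hq Hpq.
assert (E := constant_of_derive_0 (fun s => u i (phi s p) - u i (phi s q))).
assert (E0 : u i (phi 0 p) - u i (phi 0 q) = 0).
{ rewrite !(flow_0 _ _ _ Hf); try assumption. unfold u. rewrite Hpq. ring. }
assert (Ht : u i (phi t p) - u i (phi t q) = u i (phi 0 p) - u i (phi 0 q)).
{ apply E. intros s. evar_last.
  - apply (is_derive_minus (V := R_NormedModule)); apply flow_u; assumption.
  - destruct (flow_y_unique phi p q s Hf Hp Hq Hpq) as [H1 H2].
    destruct i; unfold rate; rewrite ?H1 ?H2; apply: minus_eq_zero. }
lra.
Qed.

(** * The differential of the flow *)

(** The differential of [drift f i]. *)
Definition ddrift (f : C2 -> C2) (i : axis) (p X : C2) : R :=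
  Re (xi i (f p) (push f p X)) - Re (xi i p X).

Lemma is_derive_drift (phi : R -> C2 -> C2) (T : R) (i : axis) (g : R -> C2)
  (s : R) (X : C2) :
  is_flow torus V phi -> torus (g s) -> is_derive g s X ->
  is_derive (fun t => drift (phi T) i (g t)) s (ddrift (phi T) i (g s) X).
Proof.
intros Hf Ht Hg. unfold drift, ddrift.
apply (is_derive_minus (V := R_NormedModule)).
- apply (is_derive_u i (fun t => phi T (g t))).
  + now apply (flow_in _ _ _ Hf).
  + apply is_derive_push; [now apply (flow_diff _ _ _ Hf) | exact Hg].
- now apply is_derive_u.
Qed.

(** Differentiate [z^i o phi_T = exp (drift) z^i] logarithmically. *)
Lemma xi_push (phi : R -> C2 -> C2) (T : R) (i : axis) (p X : C2) :
  is_flow torus V phi -> torus p ->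
  xi i (phi T p) (push (phi T) p X) = (xi i p X + RtoC (ddrift (phi T) i p X))%C.
Proof.
intros Hf Hp.
set (g := fun s : R => plus p (scal s X)).
assert (H0 : g 0 = p) by apply line_0.
assert (Hg : is_derive g 0 X) by apply is_derive_line.
assert (Ht : torus (g 0)) by now rewrite H0.
set (e := fun s => exp (drift (phi T) i (g s))).
assert (He : is_derive e 0 (ddrift (phi T) i p X * e 0)).
{ assert (Hd := is_derive_drift phi T i g 0 X Hf Ht Hg). rewrite H0 in Hd.
  unfold e. set (a := fun s => drift (phi T) i (g s)) in *.
  change (is_derive (fun s => exp (a s)) 0 (ddrift (phi T) i p X * exp (a 0))).
  auto_derive; [eexists; exact Hd |].
  rewrite (is_derive_unique _ _ _ Hd). ring. }
assert (E : coord i (push (phi T) (g 0) X) =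
  (RtoC (e 0) * coord i X
   + RtoC (ddrift (phi T) i p X * e 0) * coord i (g 0))%C).
{ apply (c_derive_unique (fun s => coord i (phi T (g s))) 0).
  - apply c_derive_coord, is_derive_push; [now apply (flow_diff _ _ _ Hf) | exact Hg].
  - apply c_derive_ext_loc with (fun s => (RtoC (e s) * coord i (g s))%C).
    + generalize (torus_locally g 0 X Ht Hg). apply filter_imp.
      intros s Hs. symmetry. now apply flow_coord.
    + apply c_derive_scal; [exact He | now apply c_derive_coord]. }
assert (E0 := flow_coord phi i T p Hf Hp).
unfold xi. rewrite E0. rewrite <- H0 in E0 |- * at 1 2.
rewrite E. fold (e 0). rewrite RtoC_mult. rewrite H0. field. split.
- now apply (proj1 (torus_coord p)).
- intros H. injection H. generalize (exp_pos (drift (phi T) i (g 0))).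
  unfold e. lra.
Qed.

Lemma push_plus (phi : R -> C2 -> C2) (T : R) (p X Y : C2) :
  is_flow torus V phi -> torus p ->
  push (phi T) p (plus X Y) = plus (push (phi T) p X) (push (phi T) p Y).
Proof.
intros Hf Hp. apply linear_plus.
apply (push_linear _ _ (flow_diff _ _ _ Hf T p Hp)).
Qed.

Lemma push_scal (phi : R -> C2 -> C2) (T : R) (p X : C2) (s : R) :
  is_flow torus V phi -> torus p ->
  push (phi T) p (scal s X) = scal s (push (phi T) p X).
Proof.
intros Hf Hp. apply (linear_scal (push (phi T) p)).
apply (push_linear _ _ (flow_diff _ _ _ Hf T p Hp)).
Qed.

(** [X] is tangent to the orbit of [p] under rotations of the two coordinates,
    along which the drift is constant by [flow_u_unique]. *)
Lemma ddrift_rotation (phi : R -> C2 -> C2) (T : R) (i : axis) (p X : C2) :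
  is_flow torus V phi -> torus p -> (forall j, Re (xi j p X) = 0) ->
  ddrift (phi T) i p X = 0.
Proof.
intros Hf Hp HX.
set (r := fun (j : axis) (s : R) =>
  (cos (s * Im (xi j p X)), sin (s * Im (xi j p X))) : C).
set (g := fun s => ((z1 p * r ax1 s)%C, (z2 p * r ax2 s)%C) : C2).
assert (Hr : forall j s, Cmod (r j s) = 1).
{ intros j s. unfold r. generalize (s * Im (xi j p X)). intros t.
  transitivity (sqrt 1); [| apply sqrt_1].
  unfold Cmod; simpl. f_equal. generalize (sin2_cos2 t). unfold Rsqr. lra. }
assert (Hgc : forall j s, coord j (g s) = (coord j p * r j s)%C)
  by (intros [|] s; reflexivity).
assert (H0 : g 0 = p).
{ apply C2_ext. intros j. rewrite Hgc. unfold r.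
  rewrite Rmult_0_l cos_0 sin_0. change (1, 0) with (RtoC 1). ring. }
assert (Hm : forall j s, Cmod (coord j (g s)) = Cmod (coord j p)).
{ intros j s. rewrite Hgc Cmod_mult Hr. ring. }
assert (Hd : is_derive g 0 X).
{ apply is_derive_C2. intros j.
  rewrite (coord_xi j p X Hp).
  replace (xi j p X) with ((0, Im (xi j p X)) : C)
    by (rewrite <- (HX j); now destruct (xi j p X)).
  set (b := Im (xi j p X)).
  destruct (coord j p) as [x y] eqn:Ej.
  split.
  - apply is_derive_ext with (fun s => x * cos (s * b) - y * sin (s * b)).
    { intros s. rewrite Hgc Ej. reflexivity. }
    auto_derive; [exact I |]. rewrite Rmult_0_l cos_0 sin_0. simpl. ring.
  - apply is_derive_ext with (fun s => x * sin (s * b) + y * cos (s * b)).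
    { intros s. rewrite Hgc Ej. reflexivity. }
    auto_derive; [exact I |]. rewrite Rmult_0_l cos_0 sin_0. simpl. ring. }
assert (Hgt : forall s, torus (g s)).
{ intros s. apply (proj2 (torus_coord _)). intros j.
  apply Cmod_gt_0. rewrite Hm. apply Cmod_gt_0.
  now apply (proj1 (torus_coord p)). }
assert (D := is_derive_drift phi T i g 0 X Hf (Hgt 0) Hd).
rewrite <- H0. rewrite <- (is_derive_unique _ _ _ D).
rewrite (Derive_ext _ (fun _ => drift (phi T) i p)).
- apply Derive_const.
- intros s. unfold drift. f_equal.
  + now apply flow_u_unique.
  + unfold u. now rewrite Hm.
Qed.

Definition frame (i : axis) (p : C2) : C2 :=
  match i with
  | ax1 => (z1 p, RtoC 0)
  | ax2 => (RtoC 0, z2 p)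
  end.

Lemma xi_frame (i j : axis) (p : C2) : torus p ->
  xi i p (frame j p) =
  match i, j with ax1, ax1 | ax2, ax2 => RtoC 1 | _, _ => RtoC 0 end.
Proof.
intros [H1 H2]. destruct i, j; unfold xi.
- change (z1 p / z1 p = 1)%C. field. assumption.
- change (0 / z1 p = 0)%C. field. assumption.
- change (0 / z2 p = 0)%C. field. assumption.
- change (z2 p / z2 p = 1)%C. field. assumption.
Qed.

(** The Jacobian matrix of the moduli part of the flow in the coordinates
    [u_1], [u_2]. *)
Definition jac (f : C2 -> C2) (i j : axis) (p : C2) : R :=
  Re (xi i (f p) (push f p (frame j p))).

(** Up to a purely angular vector, which does not change the moduli at time [T],
    [X] is a combination of the two radial frame vectors. *)
Lemma Re_xi_push (phi : R -> C2 -> C2) (T : R) (i : axis) (p X : C2) :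
  is_flow torus V phi -> torus p ->
  Re (xi i (phi T p) (push (phi T) p X)) =
  jac (phi T) i ax1 p * Re (xi ax1 p X) + jac (phi T) i ax2 p * Re (xi ax2 p X).
Proof.
intros Hf Hp.
set (a := Re (xi ax1 p X)). set (b := Re (xi ax2 p X)).
set (Y := plus (scal a (frame ax1 p)) (scal b (frame ax2 p)) : C2).
set (W := plus X (scal (-1) Y) : C2).
assert (HW : forall j, Re (xi j p W) = 0).
{ intros j. unfold W, Y.
  rewrite xi_plus xi_scal xi_plus !xi_scal !xi_frame; try assumption.
  unfold a, b. destruct j; destruct (xi ax1 p X), (xi ax2 p X); simpl; ring. }
assert (D := ddrift_rotation phi T i p W Hf Hp HW).
unfold ddrift in D. rewrite (HW i) in D.
unfold W, Y in D.
rewrite (push_plus phi) in D; try assumption.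
rewrite (push_scal phi) in D; try assumption.
rewrite (push_plus phi) in D; try assumption.
rewrite !(push_scal phi) in D; try assumption.
rewrite xi_plus xi_scal xi_plus !xi_scal in D.
unfold jac.
destruct (xi i (phi T p) (push (phi T) p X)).
destruct (xi i (phi T p) (push (phi T) p (frame ax1 p))).
destruct (xi i (phi T p) (push (phi T) p (frame ax2 p))).
simpl in *. lra.
Qed.

Lemma Im_xi_push (phi : R -> C2 -> C2) (T : R) (i : axis) (p X : C2) :
  is_flow torus V phi -> torus p ->
  Im (xi i (phi T p) (push (phi T) p X)) = Im (xi i p X).
Proof.
intros Hf Hp. rewrite (xi_push phi); try assumption.
destruct (xi i p X); simpl; ring.
Qed.

(** The curve [phi_T (phi_s p) = phi_s (phi_T p)] has two expressions for its
    velocity at [s = 0]. *)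
Lemma push_V (phi : R -> C2 -> C2) (T : R) (p : C2) :
  is_flow torus V phi -> torus p -> push (phi T) p (V p) = V (phi T p).
Proof.
intros Hf Hp.
assert (Ht := flow_in _ _ _ Hf T p Hp).
assert (D1 : is_derive (fun s => phi T (phi s p)) 0 (push (phi T) (phi 0 p) (V (phi 0 p)))).
{ apply (is_derive_push (phi T) (fun s => phi s p)).
  - rewrite (flow_0 _ _ _ Hf p Hp). now apply (flow_diff _ _ _ Hf).
  - now apply (flow_derive _ _ _ Hf). }
assert (D2 : is_derive (fun s => phi T (phi s p)) 0 (V (phi 0 (phi T p)))).
{ apply is_derive_ext with (fun s => phi s (phi T p)).
  - intros s. rewrite <- !(flow_add _ _ _ Hf); try assumption.
    now rewrite Rplus_comm.
  - now apply (flow_derive _ _ _ Hf). }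
rewrite !(flow_0 _ _ _ Hf) in D1, D2; try assumption.
apply C2_ext. intros i.
apply (c_derive_unique (fun s => coord i (phi T (phi s p))) 0);
  now apply c_derive_coord.
Qed.

(** The form [du_1 /\ du_2]. *)
Definition area (p X Y : C2) : R :=
  Re (xi ax1 p X) * Re (xi ax2 p Y) - Re (xi ax1 p Y) * Re (xi ax2 p X).

(** The flow preserves [V] and [h], hence also [du_1 /\ du_2] where [V] does not
    vanish, because [dh] is the contraction of [V] with that form. This avoids
    the variational equation, hence any joint regularity of the flow in time and
    space. Only the component [rate ax1] is divided by, as the remaining points
    are reached by continuity. *)
Lemma area_push_regular (phi : R -> C2 -> C2) (T : R) (p X Y : C2) :
  is_flow torus V phi -> torus p -> rate ax1 p <> 0 ->
  area (phi T p) (push (phi T) p X) (push (phi T) p Y) = area p X Y.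
Proof.
intros Hf Hp Hr.
assert (Ht := flow_in _ _ _ Hf T p Hp).
assert (HV : forall i, jac (phi T) i ax1 p * rate ax1 p
                     + jac (phi T) i ax2 p * rate ax2 p = rate i (phi T p)).
{ intros i. generalize (Re_xi_push phi T i p (V p) Hf Hp).
  rewrite (push_V phi T p Hf Hp) !xi_V; try assumption. simpl. lra. }
assert (Hh : forall Z, - rate ax2 (phi T p) * Re (xi ax1 (phi T p) (push (phi T) p Z))
    + rate ax1 (phi T p) * Re (xi ax2 (phi T p) (push (phi T) p Z))
  = - rate ax2 p * Re (xi ax1 p Z) + rate ax1 p * Re (xi ax2 p Z)).
{ intros Z. set (g := fun s : R => plus p (scal s Z)).
  assert (H0 : g 0 = p) by apply line_0.
  assert (Hg : is_derive g 0 Z) by apply is_derive_line.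
  assert (Hgt : torus (g 0)) by now rewrite H0.
  assert (D1 := is_derive_h g 0 Z Hgt Hg).
  assert (D2 : is_derive (fun s => h (phi T (g s))) 0
    (- rate ax2 (phi T p) * Re (xi ax1 (phi T p) (push (phi T) p Z))
    + rate ax1 (phi T p) * Re (xi ax2 (phi T p) (push (phi T) p Z)))).
  { rewrite <- H0 in Ht |- *. apply is_derive_h; [exact Ht |].
    apply is_derive_push; [now apply (flow_diff _ _ _ Hf) | exact Hg]. }
  rewrite <- (is_derive_unique _ _ _ D2). rewrite <- H0 at 1.
  rewrite <- H0 at 1 2 3. rewrite <- (is_derive_unique _ _ _ D1).
  apply Derive_ext_loc.
  generalize (torus_locally g 0 Z Hgt Hg). apply filter_imp.
  intros s Hs. now apply flow_h. }
assert (H1 := HV ax1). assert (H2 := HV ax2).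
assert (H3 := Hh (frame ax1 p)). assert (H4 := Hh (frame ax2 p)).
rewrite !(Re_xi_push phi) in H3, H4; try assumption.
rewrite !xi_frame in H3, H4; try assumption.
unfold RtoC, Re in H3, H4; cbn [fst] in H3, H4; fold Re in H3, H4.
unfold area. rewrite !(Re_xi_push phi); try assumption.
revert H1 H2 H3 H4.
generalize (rate ax1 (phi T p)) (rate ax2 (phi T p)).
intros r1' r2' H1 H2 H3 H4.
set (a := jac (phi T) ax1 ax1 p) in *. set (b := jac (phi T) ax1 ax2 p) in *.
set (c := jac (phi T) ax2 ax1 p) in *. set (d := jac (phi T) ax2 ax2 p) in *.
set (r1 := rate ax1 p) in *. set (r2 := rate ax2 p) in *.
(* [det K * r1 = r1]: first [K] maps [V] to [V], then its transpose maps [dh]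
   to [dh]. *)
assert (D : a * d - b * c = 1).
{ apply Rmult_eq_reg_r with r1; [| exact Hr].
  transitivity (d * (a * r1 + b * r2) - b * (c * r1 + d * r2)); [ring |].
  rewrite H1 H2. lra. }
transitivity ((a * d - b * c) * (Re (xi ax1 p X) * Re (xi ax2 p Y)
  - Re (xi ax1 p Y) * Re (xi ax2 p X))); [ring |].
rewrite D. ring.
Qed.

Lemma continuous_pair_components {U W : UniformSpace} (f : R -> U * W) (s : R) :
  continuous f s ->
  continuous (fun t => fst (f t)) s /\ continuous (fun t => snd (f t)) s.
Proof.
intros Hf.
split; apply continuous_comp; try exact Hf; destruct (f s).
- apply continuous_fst.
- apply continuous_snd.
Qed.

Lemma continuous_coord (i : axis) (g : R -> C2) (s : R) :
  continuous g s -> continuous (fun t => coord i (g t) : C_UniformSpace) s.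
Proof.
intros Hg.
destruct (continuous_pair_components (U := C_UniformSpace)
  (W := C_UniformSpace) g s Hg) as [H1 H2].
destruct i; assumption.
Qed.

Lemma continuous_Re_Im (i : axis) (g : R -> C2) (s : R) :
  continuous g s ->
  continuous (fun t => Re (coord i (g t))) s /\
  continuous (fun t => Im (coord i (g t))) s.
Proof.
intros Hg.
exact (continuous_pair_components (U := R_UniformSpace) (W := R_UniformSpace)
  _ s (continuous_coord i g s Hg)).
Qed.

Lemma continuous_Re_xi (i : axis) (w v : R -> C2) (s : R) :
  torus (w s) -> continuous w s -> continuous v s ->
  continuous (fun t => Re (xi i (w t) (v t))) s.
Proof.
intros Ht Hw Hv.
destruct (continuous_Re_Im i w s Hw) as [W1 W2].
destruct (continuous_Re_Im i v s Hv) as [V1 V2].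
assert (H0 := C_neq0_norm2 _ (proj1 (torus_coord (w s)) Ht i)).
apply continuous_ext with (fun t =>
  (Re (coord i (v t)) * Re (coord i (w t)) + Im (coord i (v t)) * Im (coord i (w t)))
  * / (Re (coord i (w t)) * Re (coord i (w t)) + Im (coord i (w t)) * Im (coord i (w t)))).
{ intros t. unfold xi, Cdiv, Cinv, Cmult, Re, Im; simpl.
  rewrite !Rmult_1_r. unfold Rdiv. ring. }
apply (continuous_mult (K := R_AbsRing)).
- apply (continuous_plus (V := R_NormedModule));
    apply (continuous_mult (K := R_AbsRing)); assumption.
- apply (continuous_comp (fun t => Re (coord i (w t)) * Re (coord i (w t))
    + Im (coord i (w t)) * Im (coord i (w t))) Rinv).
  + apply (continuous_plus (V := R_NormedModule));
      apply (continuous_mult (K := R_AbsRing)); assumption.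
  + apply continuous_Rinv. nra.
Qed.

Lemma continuous_area (w a b : R -> C2) (s : R) :
  torus (w s) -> continuous w s -> continuous a s -> continuous b s ->
  continuous (fun t => area (w t) (a t) (b t)) s.
Proof.
intros Ht Hw Ha Hb.
assert (A1 := continuous_Re_xi ax1 w a s Ht Hw Ha).
assert (A2 := continuous_Re_xi ax2 w a s Ht Hw Ha).
assert (B1 := continuous_Re_xi ax1 w b s Ht Hw Hb).
assert (B2 := continuous_Re_xi ax2 w b s Ht Hw Hb).
exact (continuous_minus (V := R_NormedModule) _ _ s
  (continuous_mult (K := R_AbsRing) _ _ s A1 B2)
  (continuous_mult (K := R_AbsRing) _ _ s B1 A2)).
Qed.

(** Moving [|z^1|] changes [y^2] strictly, so a zero of [rate ax1] is a limit of
    points where it does not vanish. *)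
Lemma rate1_frame1 (p : C2) (s : R) :
  torus p -> Rabs s < 1 -> s <> 0 -> rate ax1 p = 0 ->
  rate ax1 (plus p (scal s (frame ax1 p))) <> 0.
Proof.
intros Hp Hs1 Hs Hr Hr'.
set (q := plus p (scal s (frame ax1 p)) : C2) in *.
assert (E : y2 q = y2 p) by (unfold rate in Hr, Hr'; lra).
assert (E1 : z1 q = (RtoC (1 + s) * z1 p)%C).
{ unfold q. change (coord ax1 (plus p (scal s (frame ax1 p))) = (RtoC (1 + s) * z1 p)%C).
  rewrite coord_plus coord_scal RtoC_plus. simpl. ring. }
assert (E2 : z2 q = z2 p).
{ unfold q. change (coord ax2 (plus p (scal s (frame ax1 p))) = z2 p).
  rewrite coord_plus coord_scal. simpl. ring. }
unfold y2 in E. rewrite E1 E2 Cmod_mult Cmod_R in E.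
destruct Hp as [H1 H2]. apply Cmod_gt_0 in H1, H2.
set (a := Cmod (z1 p)) in *. set (b := Cmod (z2 p)) in *.
assert (Ha : 0 < a ^ 2) by nra. assert (Hb : 0 < b ^ 2) by nra.
rewrite Rpow_mult_distr pow2_abs in E.
assert (Hc : 0 <= (1 + s) ^ 2 * a ^ 2) by (apply Rmult_le_pos; [apply pow2_ge_0 | lra]).
assert (E3 : (1 + s) ^ 2 * a ^ 2 = a ^ 2).
{ apply Rmult_eq_reg_l with (b ^ 2); [| lra].
  assert (E4 : b ^ 2 * (1 + a ^ 2 + b ^ 2) = b ^ 2 * (1 + (1 + s) ^ 2 * a ^ 2 + b ^ 2)).
  { transitivity (b ^ 2 / (1 + (1 + s) ^ 2 * a ^ 2 + b ^ 2) *
      (1 + a ^ 2 + b ^ 2) * (1 + (1 + s) ^ 2 * a ^ 2 + b ^ 2)); [field; lra |].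
    rewrite E. field. lra. }
  lra. }
apply Rabs_lt_between in Hs1.
assert (E5 : (1 + s) ^ 2 = 1).
{ apply Rmult_eq_reg_r with (a ^ 2); lra. }
nra.
Qed.

(** Liouville: across the curve [rate ax1 = 0] the identity extends because the
    flow is of class C^1. *)
Lemma area_push (phi : R -> C2 -> C2) (T : R) (p X Y : C2) :
  is_flow torus V phi -> torus p ->
  area (phi T p) (push (phi T) p X) (push (phi T) p Y) = area p X Y.
Proof.
intros Hf Hp.
destruct (Req_dec (rate ax1 p) 0) as [Hr | Hr]; [| now apply area_push_regular].
set (q := fun s : R => plus p (scal s (frame ax1 p)) : C2).
assert (H0 : q 0 = p) by apply line_0.
assert (Hq : is_derive q 0 (frame ax1 p)) by apply is_derive_line.
assert (Hqt : torus (q 0)) by now rewrite H0.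
set (d := fun s => area (phi T (q s)) (push (phi T) (q s) X) (push (phi T) (q s) Y)
                   - area (q s) X Y).
assert (Cq : continuous q 0)
  by exact (ex_derive_continuous q 0 (ex_intro _ _ Hq)).
assert (Cphi : continuous (fun s => phi T (q s)) 0).
{ apply (ex_derive_continuous (fun s => phi T (q s))). eexists.
  apply is_derive_push; [now apply (flow_diff _ _ _ Hf) | exact Hq]. }
assert (Cpush : forall Z, continuous (fun s => push (phi T) (q s) Z) 0).
{ intros Z. apply (continuous_comp q (fun r => push (phi T) r Z)); [exact Cq |].
  now apply (flow_C1 _ _ _ Hf). }
assert (Cc : forall Z, continuous (fun _ : R => Z : C2) 0)
  by (intros Z; apply continuous_const).
assert (Cd : continuous d 0).
{ assert (Ht := flow_in _ _ _ Hf T _ Hqt).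
  apply (continuous_minus (V := R_NormedModule)
    (fun s => area (phi T (q s)) (push (phi T) (q s) X) (push (phi T) (q s) Y))).
  - now apply (continuous_area (fun s => phi T (q s))).
  - now apply (continuous_area q (fun _ => X) (fun _ => Y)). }
enough (D0 : d 0 = 0) by (unfold d in D0; rewrite H0 in D0; lra).
destruct (Req_dec (d 0) 0) as [D | D]; [exact D | exfalso].
assert (L : locally 0 (fun s => d s <> 0)) by (apply (Cd (fun r => r <> 0)); apply (open_neq 0), D).
generalize (filter_and _ _ L (torus_locally q 0 _ Hqt Hq)).
intros [e He].
(* Smaller than the radius [e], and small enough for [rate1_frame1]. *)
set (s := Rmin (e / 2) (1 / 2)).
assert (Hs : 0 < s /\ s < e /\ s <= 1 / 2).
{ assert (H := cond_pos e). unfold s. repeat split.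
  - apply Rmin_pos; lra.
  - apply Rle_lt_trans with (1 := Rmin_l _ _). lra.
  - apply Rmin_r. }
assert (Hb : ball 0 e s).
{ change (Rabs (s - 0) < e). rewrite Rminus_0_r Rabs_pos_eq; lra. }
destruct (He s Hb) as [Hds Hts]. apply Hds. unfold d.
rewrite (area_push_regular phi T (q s)); try assumption; [ring |].
apply rate1_frame1; try assumption; [rewrite Rabs_pos_eq; lra | lra].
Qed.

(** * The conjugated complex structure *)

Lemma jac_det (phi : R -> C2 -> C2) (T : R) (p : C2) :
  is_flow torus V phi -> torus p ->
  jac (phi T) ax1 ax1 p * jac (phi T) ax2 ax2 p
  - jac (phi T) ax1 ax2 p * jac (phi T) ax2 ax1 p = 1.
Proof.
intros Hf Hp.
generalize (area_push phi T p (frame ax1 p) (frame ax2 p) Hf Hp).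
unfold area. fold (jac (phi T) ax1 ax1 p) (jac (phi T) ax2 ax2 p)
  (jac (phi T) ax1 ax2 p) (jac (phi T) ax2 ax1 p).
rewrite !xi_frame; try assumption. simpl. lra.
Qed.

Lemma xi_I_minus (i : axis) (p q X : C2) :
  xi i p (I_minus q X) = (Ci * xi i p X)%C.
Proof. destruct i; unfold xi, Cdiv; simpl; ring. Qed.

(** In logarithmic coordinates the differential of the flow is the Jacobian
    matrix [K] on the moduli and the identity on the angles, so that [I_+] is [K] from moduli to
    angles and [- K^-1] from angles to moduli; as [det K = 1], the inverse is
    the adjugate. *)
Lemma xi_I_plus (phi : R -> C2 -> C2) (T : R) (p X : C2) :
  is_flow torus V phi -> torus p ->
  let a := jac (phi T) ax1 ax1 p in let b := jac (phi T) ax1 ax2 p in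
  let c := jac (phi T) ax2 ax1 p in let d := jac (phi T) ax2 ax2 p in
  let x1 := xi ax1 p X in let x2 := xi ax2 p X in
  xi ax1 p (I_plus (phi T) p X) =
    (- (d * Im x1 - b * Im x2), a * Re x1 + b * Re x2) /\
  xi ax2 p (I_plus (phi T) p X) =
    (- (a * Im x2 - c * Im x1), c * Re x1 + d * Re x2).
Proof.
intros Hf Hp a b c d x1 x2.
assert (Ht := flow_in _ _ _ Hf T p Hp).
assert (D : a * d - b * c = 1) by now apply jac_det.
set (P := push (phi T) p).
(* The vector whose image under the differential is [I_-] of the image of [X]. *)
set (v1 := (- (d * Im x1 - b * Im x2), a * Re x1 + b * Re x2) : C).
set (v2 := (- (a * Im x2 - c * Im x1), c * Re x1 + d * Re x2) : C).
set (Y := ((z1 p * v1)%C, (z2 p * v2)%C) : C2).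
destruct Hp as [Hp1 Hp2]. assert (Hp : torus p) by now split.
assert (Y1 : xi ax1 p Y = v1).
{ change (z1 p * v1 / z1 p = v1)%C. field. assumption. }
assert (Y2 : xi ax2 p Y = v2).
{ change (z2 p * v2 / z2 p = v2)%C. field. assumption. }
assert (HP1 : forall i Z, Re (xi i (phi T p) (P Z)) =
  jac (phi T) i ax1 p * Re (xi ax1 p Z) + jac (phi T) i ax2 p * Re (xi ax2 p Z))
  by (intros; now apply Re_xi_push).
assert (HP2 : forall i Z, Im (xi i (phi T p) (P Z)) = Im (xi i p Z))
  by (intros; now apply Im_xi_push).
assert (C_eq : forall v w : C, Re v = Re w -> Im v = Im w -> v = w)
  by (intros [? ?] [? ?]; simpl; congruence).
assert (EY : P Y = I_minus (phi T p) (P X)).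
{ apply (xi_ext (phi T p)); [exact Ht |]. intros i. rewrite xi_I_minus.
  apply C_eq.
  - transitivity (- Im (xi i (phi T p) (P X))).
    2:{ destruct (xi i (phi T p) (P X)); simpl; ring. }
    rewrite HP1 HP2 Y1 Y2.
    change (Re v1) with (- (d * Im x1 - b * Im x2)).
    change (Re v2) with (- (a * Im x2 - c * Im x1)).
    destruct i; fold a b c d x1 x2.
    + transitivity (- ((a * d - b * c) * Im x1)); [ring |]. rewrite D. ring.
    + transitivity (- ((a * d - b * c) * Im x2)); [ring |]. rewrite D. ring.
  - transitivity (Re (xi i (phi T p) (P X))).
    2:{ destruct (xi i (phi T p) (P X)); simpl; ring. }
    rewrite HP2 HP1. destruct i; fold a b c d x1 x2; rewrite ?Y1 ?Y2; reflexivity. }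
assert (EZ : P (I_plus (phi T) p X) = I_minus (phi T p) (P X)).
{ unfold I_plus, inverse. apply epsilon_spec. now exists Y. }
rewrite <- EY in EZ. set (Z := I_plus (phi T) p X) in *.
assert (EI : forall i, Im (xi i p Z) = Im (xi i p Y)).
{ intros i. rewrite <- !HP2. now rewrite EZ. }
assert (ER : forall i, Re (xi i (phi T p) (P Z)) = Re (xi i (phi T p) (P Y)))
  by (intros i; now rewrite EZ).
assert (E1 := ER ax1). assert (E2 := ER ax2). rewrite !HP1 in E1, E2.
fold a b in E1. fold c d in E2.
assert (R1 : Re (xi ax1 p Z) = Re (xi ax1 p Y)).
{ rewrite <- (Rmult_1_l (Re (xi ax1 p Z))), <- (Rmult_1_l (Re (xi ax1 p Y))).
  rewrite <- D.
  transitivity (d * (a * Re (xi ax1 p Z) + b * Re (xi ax2 p Z))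
              - b * (c * Re (xi ax1 p Z) + d * Re (xi ax2 p Z))); [ring |].
  rewrite E1 E2. ring. }
assert (R2 : Re (xi ax2 p Z) = Re (xi ax2 p Y)).
{ rewrite <- (Rmult_1_l (Re (xi ax2 p Z))), <- (Rmult_1_l (Re (xi ax2 p Y))).
  rewrite <- D.
  transitivity (a * (c * Re (xi ax1 p Z) + d * Re (xi ax2 p Z))
              - c * (a * Re (xi ax1 p Z) + b * Re (xi ax2 p Z))); [ring |].
  rewrite E1 E2. ring. }
rewrite <- Y1, <- Y2. split; apply C_eq; auto.
Qed.

(** * The two-form and the angles *)

Lemma continuous_rate_flow (phi : R -> C2 -> C2) (i : axis) (t : R) (p : C2) :
  is_flow torus V phi -> torus p -> continuous (fun s => rate i (phi s p)) t.
Proof.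
intros Hf Hp. destruct (flow_y phi t p Hf Hp) as [H1 H2].
apply (ex_derive_continuous (V := R_NormedModule)).
destruct i; unfold rate.
- set (b := fun s => y2 (phi s p)) in *.
  change (ex_derive (fun s => - (1 / 2) + 3 / 2 * b s) t).
  auto_derive. eexists; eassumption.
- set (b := fun s => y1 (phi s p)) in *.
  change (ex_derive (fun s => 1 / 2 - 3 / 2 * b s) t).
  auto_derive. eexists; eassumption.
Qed.

(** As the flow fixes the angles, the integrand is
    [du_2/dt dtheta_1 - du_1/dt dtheta_2] along the flow line. *)
Lemma int_pull_drift (phi : R -> C2 -> C2) (T : R) (p X : C2) :
  is_flow torus V phi -> torus p ->
  int_pull phi T (star I_minus (dfun h)) p X =
  drift (phi T) ax2 p * Im (xi ax1 p X) - drift (phi T) ax1 p * Im (xi ax2 p X).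
Proof.
intros Hf Hp. unfold int_pull. apply is_RInt_unique.
set (t1 := Im (xi ax1 p X)). set (t2 := Im (xi ax2 p X)).
assert (EI : forall t, rate ax2 (phi t p) * t1 - rate ax1 (phi t p) * t2 =
  pull (phi t) (star I_minus (dfun h)) p X).
{ intros t. assert (Ht := flow_in _ _ _ Hf t p Hp).
  unfold pull, star. rewrite dfun_h; [| exact Ht].
  rewrite !xi_I_minus.
  assert (HR : forall w : C, Re (Ci * w) = - Im w)
    by (intros [w1 w2]; simpl; ring).
  rewrite !HR !(Im_xi_push phi); try assumption. unfold t1, t2. ring. }
apply (is_RInt_ext _ _ _ _ _ (fun t _ => EI t)).
evar_last.
- apply (is_RInt_derive (V := R_CompleteNormedModule)
    (fun t => u ax2 (phi t p) * t1 - u ax1 (phi t p) * t2)).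
  + intros t _.
    exact (is_derive_minus (V := R_NormedModule) _ _ t _ _
      (is_derive_scal_l (V := R_NormedModule) _ _ _ t1 (flow_u phi ax2 t p Hf Hp))
      (is_derive_scal_l (V := R_NormedModule) _ _ _ t2 (flow_u phi ax1 t p Hf Hp))).
  + intros t _.
    exact (continuous_minus (V := R_NormedModule) _ _ t
      (continuous_mult (K := R_AbsRing) _ _ t
        (continuous_rate_flow phi ax2 t p Hf Hp) (continuous_const t1 t))
      (continuous_mult (K := R_AbsRing) _ _ t
        (continuous_rate_flow phi ax1 t p Hf Hp) (continuous_const t2 t))).
- unfold drift. rewrite (flow_0 _ _ _ Hf p Hp).
  unfold minus, plus, opp; simpl. ring.
Qed.

Lemma is_derive_Im_xi (i : axis) (g : R -> C2) (s : R) (X Y : C2) :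
  torus (g s) -> is_derive g s X ->
  is_derive (fun t => Im (xi i (g t) Y)) s (- Im (xi i (g s) X * xi i (g s) Y)%C).
Proof.
intros Ht Hg.
destruct (c_derive_coord i g s X Hg) as [H1 H2].
assert (H0 := C_neq0_norm2 _ (proj1 (torus_coord (g s)) Ht i)).
unfold xi. destruct (coord i Y) as [y y'], (coord i X) as [x x'].
set (a := fun t => Re (coord i (g t))) in *.
set (b := fun t => Im (coord i (g t))) in *.
change (0 < a s ^ 2 + b s ^ 2) in H0.
apply is_derive_ext with (fun t => (y' * a t - y * b t) / (a t ^ 2 + b t ^ 2)).
{ intros t. unfold a, b, Cdiv, Cinv, Cmult, Re, Im; simpl. unfold Rdiv. ring. }
simpl in H1, H2.
auto_derive.
- repeat split; try (eexists; eassumption). simpl in *. lra.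
- change (fun x : R => a x) with a. change (fun x : R => b x) with b.
  rewrite (is_derive_unique _ _ _ H1) (is_derive_unique _ _ _ H2).
  unfold Cdiv, Cinv, Cmult, Re, Im; simpl.
  change (fst (coord i (g s))) with (a s). change (snd (coord i (g s))) with (b s).
  simpl in H0. field. lra.
Qed.

(** Only the drifts are differentiated in the end: the forms [dtheta_a] are
    closed, so the derivatives of their coefficients cancel. *)
Lemma F_form_ddrift (phi : R -> C2 -> C2) (T : R) (p X Y : C2) :
  is_flow torus V phi -> torus p ->
  F_form phi T p X Y =
    wedge (ddrift (phi T) ax2 p) (fun Z => Im (xi ax1 p Z)) X Y
    - wedge (ddrift (phi T) ax1 p) (fun Z => Im (xi ax2 p Z)) X Y.
Proof.
intros Hf Hp.
assert (D : forall W Z : C2,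
  dfun (fun q => int_pull phi T (star I_minus (dfun h)) q Z) p W =
  (ddrift (phi T) ax2 p W * Im (xi ax1 p Z)
   + drift (phi T) ax2 p * - Im (xi ax1 p W * xi ax1 p Z)%C)
  - (ddrift (phi T) ax1 p W * Im (xi ax2 p Z)
   + drift (phi T) ax1 p * - Im (xi ax2 p W * xi ax2 p Z)%C)).
{ intros W Z. apply dfun_value. intros g H0 Hg.
  rewrite <- H0 in Hp |- *.
  apply is_derive_ext_loc with (fun t =>
    drift (phi T) ax2 (g t) * Im (xi ax1 (g t) Z)
    - drift (phi T) ax1 (g t) * Im (xi ax2 (g t) Z)).
  { generalize (torus_locally g 0 W Hp Hg). apply filter_imp.
    intros t Hgt. symmetry. now apply int_pull_drift. }
  apply (is_derive_minus (V := R_NormedModule));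
    apply (is_derive_mult (K := R_AbsRing));
    try (intros; apply Rmult_comm);
    (now apply is_derive_drift) || (now apply is_derive_Im_xi). }
unfold F_form, ext_d, wedge. rewrite !D.
rewrite (Cmult_comm (xi ax1 p Y)) (Cmult_comm (xi ax2 p Y)). ring.
Qed.

Lemma ddrift_jac (phi : R -> C2 -> C2) (T : R) (i : axis) (p X : C2) :
  is_flow torus V phi -> torus p ->
  ddrift (phi T) i p X =
  jac (phi T) i ax1 p * Re (xi ax1 p X) + jac (phi T) i ax2 p * Re (xi ax2 p X)
  - Re (xi i p X).
Proof. intros Hf Hp. unfold ddrift. now rewrite (Re_xi_push phi). Qed.

(** A branch that is merely continuous is differentiable: near [w] it is its value
    at [w] plus the arc tangent of [Im (z / w) / Re (z / w)], because its own
    continuity keeps the increment below [PI / 2]. *)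
Lemma dfun_arg (arg : C -> R) (i : axis) (p X : C2) :
  torus p -> arg_branch arg (coord i p) ->
  dfun (fun q => arg (coord i q)) p X = Im (xi i p X).
Proof.
intros Hp Ha. apply dfun_value. intros g H0 Hg.
rewrite <- H0 in Hp, Ha |- *. clear H0 p.
destruct (c_derive_coord i g 0 X Hg) as [D1 D2].
assert (N0 := C_neq0_norm2 _ (proj1 (torus_coord _) Hp i)).
assert (Cc : continuous (fun t => coord i (g t) : C_UniformSpace) 0).
{ apply continuous_coord. exact (ex_derive_continuous g 0 (ex_intro _ _ Hg)). }
destruct (locally_singleton _ _ Ha) as [Ca E0].
assert (L1 : locally 0 (fun t =>
  continuous (T := C_UniformSpace) arg (coord i (g t)) /\
  coord i (g t) = (RtoC (Cmod (coord i (g t))) *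
    (cos (arg (coord i (g t))), sin (arg (coord i (g t)))))%C)) by exact (Cc _ Ha).
assert (L2 : locally 0 (fun t => Rabs (arg (coord i (g t)) - arg (coord i (g 0))) < PI / 2)).
{ assert (Hpi : 0 < PI / 2) by (generalize PI_RGT_0; lra).
  exact (continuous_comp (fun t => coord i (g t) : C_UniformSpace) arg 0 Cc Ca
    _ (locally_ball (arg (coord i (g 0))) (mkposreal _ Hpi))). }
assert (L3 := torus_locally g 0 X Hp Hg).
unfold xi. destruct (coord i X) as [x x'].
set (a := fun t => Re (coord i (g t))) in *.
set (b := fun t => Im (coord i (g t))) in *.
set (th := arg (coord i (g 0))) in *.
change (0 < a 0 ^ 2 + b 0 ^ 2) in N0.
apply is_derive_ext_loc with
  (fun t => th + atan ((b t * a 0 - a t * b 0) / (a t * a 0 + b t * b 0))).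
{ generalize (filter_and _ _ L1 (filter_and _ _ L2 L3)). apply filter_imp.
  intros t [[_ Et] [Hd Ht]].
  set (al := arg (coord i (g t))) in *.
  set (r0 := Cmod (coord i (g 0))) in *. set (r := Cmod (coord i (g t))) in *.
  assert (Hr0 : 0 < r0) by (apply Cmod_gt_0; now apply (proj1 (torus_coord _))).
  assert (Hr : 0 < r) by (apply Cmod_gt_0; now apply (proj1 (torus_coord _))).
  assert (Ea : a t = r * cos al) by (unfold a; rewrite Et; simpl; ring).
  assert (Eb : b t = r * sin al) by (unfold b; rewrite Et; simpl; ring).
  assert (Ea0 : a 0 = r0 * cos th) by (unfold a; rewrite E0; simpl; ring).
  assert (Eb0 : b 0 = r0 * sin th) by (unfold b; rewrite E0; simpl; ring).
  apply Rabs_lt_between in Hd.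
  assert (Hc : 0 < cos (al - th)) by (apply cos_gt_0; lra).
  replace ((b t * a 0 - a t * b 0) / (a t * a 0 + b t * b 0)) with (tan (al - th)).
  - rewrite atan_tan; lra.
  - rewrite Ea Eb Ea0 Eb0.
    replace (r * sin al * (r0 * cos th) - r * cos al * (r0 * sin th))
      with (r * r0 * sin (al - th)) by (rewrite sin_minus; ring).
    replace (r * cos al * (r0 * cos th) + r * sin al * (r0 * sin th))
      with (r * r0 * cos (al - th)) by (rewrite cos_minus; ring).
    unfold tan. field. lra. }
simpl in D1, D2.
auto_derive.
- repeat split; try (eexists; eassumption). nra.
- change (fun x : R => a x) with a. change (fun x : R => b x) with b.
  rewrite (is_derive_unique _ _ _ D1) (is_derive_unique _ _ _ D2).
  replace (b 0 * a 0 + - (a 0 * b 0)) with 0 by ring.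
  unfold Cdiv, Cinv, Cmult, Re, Im; simpl.
  change (fst (coord i (g 0))) with (a 0). change (snd (coord i (g 0))) with (b 0).
  simpl in N0. field. nra.
Qed.

Theorem proposition6p9 :
  forall (phi : R -> C2 -> C2), is_flow torus V phi ->
  forall (T : R),
  let I_p : endo_field := I_plus (phi T) in
  let I_m : endo_field := I_minus in
  let F := F_form phi T in
  (forall p, torus p -> forall X,
     minus (I_p p X) (I_m p X) = opp (QF F p X)) /\
  (forall p, torus p ->
   forall arg1 arg2 : C -> R,
     arg_branch arg1 (z1 p) -> arg_branch arg2 (z2 p) ->
   let dtheta1 := dfun (fun q => arg1 (z1 q)) in
   let dtheta2 := dfun (fun q => arg2 (z2 q)) in
   forall X Y,
     F p X Y =
       - wedge (fun Z => star I_p dtheta1 p Z - star I_m dtheta1 p Z)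
               (dtheta2 p) X Y
       + wedge (fun Z => star I_p dtheta2 p Z - star I_m dtheta2 p Z)
               (dtheta1 p) X Y).
Proof.
intros phi Hf T I_p I_m F. split.
- intros p Hp X.
  destruct (xi_I_plus phi T p X Hf Hp) as [P1 P2].
  set (b1 := (jac (phi T) ax2 ax2 p * Im (xi ax1 p X) - Im (xi ax1 p X)
             - jac (phi T) ax1 ax2 p * Im (xi ax2 p X),
             - ddrift (phi T) ax1 p X) : C).
  set (b2 := (jac (phi T) ax2 ax1 p * Im (xi ax1 p X)
             - jac (phi T) ax1 ax1 p * Im (xi ax2 p X) + Im (xi ax2 p X),
             ddrift (phi T) ax2 p X) : C).
  assert (EQ : QF F p X = ((z1 p * b1)%C, (- (z2 p * b2))%C)).
  { apply Qsharp_log; [exact Hp |]. intros Y. unfold F, b1, b2.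
    rewrite F_form_ddrift; try assumption. unfold wedge.
    rewrite !(ddrift_jac phi T _ p Y); try assumption.
    destruct (xi ax1 p Y), (xi ax2 p Y). simpl. ring. }
  assert (EQ1 : xi ax1 p (QF F p X) = b1).
  { rewrite EQ. change (z1 p * b1 / z1 p = b1)%C. field. apply Hp. }
  assert (EQ2 : xi ax2 p (QF F p X) = (- b2)%C).
  { rewrite EQ. change (- (z2 p * b2) / z2 p = - b2)%C. field. apply Hp. }
  apply (xi_ext p); [exact Hp |]. intros i.
  assert (Hm : forall Z : C2, xi i p (opp Z) = (- xi i p Z)%C).
  { intros Z. destruct i; unfold xi, Cdiv; simpl.
    - change (- z1 Z * / z1 p = - (z1 Z * / z1 p))%C. ring.
    - change (- z2 Z * / z2 p = - (z2 Z * / z2 p))%C. ring. }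
  unfold minus. rewrite xi_plus !Hm xi_I_minus. clear EQ Hm.
  destruct i.
  + rewrite P1 EQ1. unfold b1. rewrite (ddrift_jac phi); try assumption.
    destruct (xi ax1 p X), (xi ax2 p X).
    unfold Cplus, Copp, Cmult, Ci; simpl. f_equal; ring.
  + rewrite P2 EQ2. unfold b2. rewrite (ddrift_jac phi); try assumption.
    destruct (xi ax1 p X), (xi ax2 p X).
    unfold Cplus, Copp, Cmult, Ci; simpl. f_equal; ring.
- intros p Hp arg1 arg2 H1 H2 dtheta1 dtheta2 X Y.
  assert (E1 : forall Z, dtheta1 p Z = Im (xi ax1 p Z))
    by (intros Z; exact (dfun_arg arg1 ax1 p Z Hp H1)).
  assert (E2 : forall Z, dtheta2 p Z = Im (xi ax2 p Z))
    by (intros Z; exact (dfun_arg arg2 ax2 p Z Hp H2)).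
  assert (D1 : forall Z, star I_p dtheta1 p Z - star I_m dtheta1 p Z
                         = ddrift (phi T) ax1 p Z).
  { intros Z. unfold star. rewrite !E1 xi_I_minus (proj1 (xi_I_plus phi T p Z Hf Hp)).
    rewrite (ddrift_jac phi); try assumption.
    destruct (xi ax1 p Z), (xi ax2 p Z). simpl. ring. }
  assert (D2 : forall Z, star I_p dtheta2 p Z - star I_m dtheta2 p Z
                         = ddrift (phi T) ax2 p Z).
  { intros Z. unfold star. rewrite !E2 xi_I_minus (proj2 (xi_I_plus phi T p Z Hf Hp)).
    rewrite (ddrift_jac phi); try assumption.
    destruct (xi ax1 p Z), (xi ax2 p Z). simpl. ring. }
  unfold F. rewrite F_form_ddrift; try assumption.
  unfold wedge. rewrite !D1 !D2 !E1 !E2. ring.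
Qed.
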